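(* Let $V$ be a finite-dimensional $\Bbbk$-vector space and let $W\subseteq S^dV$ be a linear series (linear subspace). Suppose $W^\perp$ is generated in degrees less than or equal to $\delta$, where $\delta$ is a positive integer. Then $$ r(W)\ \geq\ sr(W)\ \geq\ cr(W)\ \geq\ \frac{\ell(A^W)}{\delta} . $$
   Context: $\Bbbk$ is an algebraically closed field of characteristic $0$. $S^dV$ is the space of forms of degree $d$ in a basis $x_1,\dots,x_n$ of $V$. $T=\Bbbk[\partial_1,\dots,\partial_n]$ acts on $\Bbbk[x_1,\dots,x_n]$ by differentiation ($\partial_i=\partial/\partial x_i$), and is also the homogeneous coordinate ring of $\mathbb{P}V$ (lines in $V$). $W^\perp=\{\Theta\in T:\Theta F=0\text{ for all }F\in W\}$, $A^W=T/W^\perp$, and $\ell(A^W)=\dim_{\Bbbk}A^W$ is its length. The simultaneous Waring rank $r(W)$ is the least $r$ such that $W\subseteq\operatorname{span}\{\ell_1^d,\dots,\ell_r^d\}$ for some linear forms $\ell_i\in V$; equivalently the least length of a reduced zero-dimensional apolar scheme. A closed subscheme $Z\subset\mathbb{P}V$ is apolar to $W$ if its saturated homogeneous defining ideal satisfies $I(Z)\subseteq W^\perp$. The smoothable rank $sr(W)$ is the least length of a smoothable zero-dimensional scheme apolar to $W$ (smoothable: a flat limit of reduced zero-dimensional schemes), and the cactus rank $cr(W)$ is the least length of any zero-dimensional scheme apolar to $W$. *)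

(* Defs.v *)
From Stdlib Require Import ClassicalEpsilon.
From HB Require Import structures.
From mathcomp Require Import all_boot all_order all_algebra.
From mathcomp Require Import fraction.
From mathcomp Require Export mpoly.

Set Implicit Arguments.
Unset Strict Implicit.
Unset Printing Implicit Defensive.

Import GRing.Theory.
Local Open Scope ring_scope.

(* The value is unspecified when no natural number satisfies P. *)
Definition least (P : nat -> Prop) : nat :=
  epsilon (inhabits 0%N) (fun r => P r /\ forall s, P s -> (r <= s)%N).

(* Subsets of F[X_1..X_n], in particular homogeneous ideals, are Prop-valued
   predicates. *)
Section Ideals.

Variables (n : nat) (F : fieldType).
Local Notation T := {mpoly F[n]}.
Implicit Types A I J : T -> Prop.

Definition is_ideal I : Prop :=
  [/\ I 0, forall f g, I f -> I g -> I (f + g) & forall g f, I f -> I (g * f)].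

Definition is_homogeneous I : Prop :=
  forall f, I f -> forall e, I (pihomog mdeg e f).

(* f belongs to the saturation iff m^N f is contained in I for some N, where m
   is the irrelevant ideal; m^N is generated by the forms of degree N. *)
Definition saturation I : T -> Prop :=
  fun f => exists N : nat, forall g : T, g \is N.-homog -> I (g * f).

Definition is_saturated I : Prop := forall f, saturation I f -> I f.

Definition is_radical I : Prop := forall f (m : nat), I (f ^+ m) -> I f.

Definition generated_in_degrees_le I (delta : nat) : Prop :=
  forall f, I f -> exists s : seq (T * T),
    (forall p, p \in s ->
       I p.2 /\ exists2 e : nat, (e <= delta)%N & p.2 \is e.-homog) /\
    f = \sum_(p <- s) p.1 * p.2.

(* For linear subspaces A and I, the quotient A / (A `&` I) has dimension r: it
   has a basis consisting of the classes of r elements of A. *)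
Definition quotient_dim A I (r : nat) : Prop :=
  exists b : 'I_r -> T, (forall i, A (b i)) /\
    forall f, A f -> exists! c : {ffun 'I_r -> F}, I (f - \sum_i c i *: b i).

(* A closed subscheme Z of the projective space Proj T is given by its saturated
   homogeneous ideal I.  It is zero-dimensional (or empty, when r = 0) of length
   r when its Hilbert polynomial is the constant r. *)
Definition zero_dim_scheme I (r : nat) : Prop :=
  [/\ is_ideal I, is_homogeneous I, is_saturated I &
      exists N : nat, forall e, (N <= e)%N ->
        quotient_dim (fun f => f \is e.-homog) I r].

(* Z = Proj (T / I) is reduced iff its saturated ideal is radical. *)
Definition reduced_zero_dim_scheme I (r : nat) : Prop :=
  zero_dim_scheme I r /\ is_radical I.

End Ideals.

Section FlatLimits.

Variables (n : nat) (k : fieldType).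

(* Spec R is the base of a one-parameter family over k: R is a k-algebra (via
   iota), rho is a k-point, and the last three clauses say that the local ring
   of R at this point is a discrete valuation ring with uniformizer t. *)
Definition pointed_curve (R : idomainType) (iota : {rmorphism k -> R})
    (rho : {rmorphism R -> k}) (t : R) : Prop :=
  [/\ cancel iota rho, t != 0, rho t = 0 &
      forall a : R, a != 0 ->
        exists (m : nat) (u : R), a = u * t ^+ m /\ rho u != 0].

(* Let K be the fraction field of R.  The closure in P^(n-1)_R of the subscheme
   of P^(n-1)_K with saturated ideal J is the unique extension of it that is
   flat at the point rho, and its ideal is the contraction of J to
   R[X_1..X_n].  The fibre of this closure at rho is cut out by the image of the
   contraction under rho, whose saturation is the ideal of the flat limit. *)
Definition flat_limit (R : idomainType) (rho : {rmorphism R -> k})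
    (J : {mpoly {fraction R}[n]} -> Prop) : {mpoly k[n]} -> Prop :=
  saturation (fun g => exists G : {mpoly R[n]},
    J (map_mpoly (@tofrac R) G) /\ g = map_mpoly rho G).

(* The generic fibre of the family is reduced; in characteristic 0 this is the
   same as being geometrically reduced, i.e. as the general fibre being
   reduced. *)
Definition smoothable_scheme (I : {mpoly k[n]} -> Prop) (r : nat) : Prop :=
  zero_dim_scheme I r /\
  exists (R : idomainType) (iota : {rmorphism k -> R})
         (rho : {rmorphism R -> k}) (t : R),
    pointed_curve iota rho t /\
    exists J : {mpoly {fraction R}[n]} -> Prop,
      reduced_zero_dim_scheme J r /\ forall f, I f <-> flat_limit rho J f.

End FlatLimits.

Section Ranks.

Variables (n : nat) (k : fieldType).
(* {mpoly k[n]} is both the ring k[x_1..x_n] and the ring T = k[d_1..d_n]. *)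
Implicit Types (W : {pred {mpoly k[n]}}).

Definition diff_act (Theta F : {mpoly k[n]}) : {mpoly k[n]} :=
  \sum_(m <- msupp Theta) Theta@_m *: F^`M[m].

Definition perp W : {mpoly k[n]} -> Prop :=
  fun Theta => forall F, F \in W -> diff_act Theta F = 0.

(* The length of A^W = T / perp W. *)
Definition apolar_length W : nat :=
  least (quotient_dim (fun _ => True) (perp W)).

Definition is_linear_series (d : nat) W : Prop :=
  submod_closed W /\ forall F, F \in W -> F \is d.-homog.

Definition apolar W (I : {mpoly k[n]} -> Prop) : Prop :=
  forall Theta, I Theta -> perp W Theta.

Definition waring_rank (d : nat) W : nat :=
  least (fun r => exists l : 'I_r -> {mpoly k[n]},
    (forall i, l i \is 1.-homog) /\
    forall F, F \in W -> exists c : 'I_r -> k, F = \sum_i c i *: l i ^+ d).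

Definition smoothable_rank W : nat :=
  least (fun r => exists2 I, smoothable_scheme I r & apolar W I).

Definition cactus_rank W : nat :=
  least (fun r => exists2 I, zero_dim_scheme I r & apolar W I).

End Ranks.

(* Main.v *)
Require Import Defs.
From Stdlib Require Import ClassicalEpsilon.
From HB Require Import structures.
From mathcomp Require Import all_boot all_order all_algebra.
From mathcomp Require Import fraction ring zify ssrcomplements bigenough.
Import GRing.Theory BigEnough.
Local Open Scope ring_scope.

Set Implicit Arguments.
Unset Strict Implicit.
Unset Printing Implicit Defensive.

(** Why the theorem is true.

    Lower bound on the cactus rank.  Let [I] be the saturated ideal of a scheme
    of length [r] apolar to [W], and [M = T / I].  Since [perp W] contains every
    form of degree [d + 1] and is generated in degrees at most [delta], its forms
    of degree [delta] have no common zero in projective space.  A general one,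
    [g], therefore avoids the finitely many points of the scheme and is a
    non-zero-divisor on [M] ([exists_regular_form]); then [T / (I + (g))] has length
    [delta * r] and surjects onto [A^W].

    Both steps are carried out with elements and without Hilbert functions.
    The only finiteness that is used about [I] is that more than [r] forms of
    one large degree are linearly dependent modulo [I].
    - A point of the scheme is detected by a form [f] outside [I] on which every
      variable acts, modulo [I], as a scalar multiple of one fixed variable
      ([associated]).  Such an [f] exists among the multiples of any form
      outside [I]: it is killed, modulo [I], by a nonzero binary form of high
      degree in any two given linear forms, and binary forms split over an
      algebraically closed field ([exists_associated_multiple]).  If a form [g]
      of degree [delta] is a zero divisor, it vanishes at such a point; choosing
      the next [g] nonzero at the points found so far yields points whose
      eigenvectors are independent, so the search stops after at most [r]
      points.
    - Given more than [delta * r] forms, multiply each by a power of [g] so that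
      all degrees fall in one window of length [delta].  More than [r] of them
      share a degree, hence are dependent modulo [I]; cancelling the smallest
      power of [g] leaves a dependency modulo [perp W] between the original
      forms ([forms_dependent]).

    Comparison with the Waring rank.  In characteristic 0 the powers of linear
    forms span the forms of degree [d] ([waring_exists]), so the Waring rank is
    attained.  From an optimal decomposition keep pairwise distinct points
    ([exists_distinct_points]); by the apolarity lemma
    ([diff_act_linear_form_pow]) their ideal annihilates [W], and it is
    smoothable because it is the flat limit of its own constant family over the
    affine line ([points_ideal_smoothable]).  A smoothable scheme is in
    particular a zero-dimensional one, which compares the other two ranks. *)

(** * Least natural numbers *)

Lemma leastP (P : nat -> Prop) : (exists r, P r) ->
  P (least P) /\ forall s, P s -> (least P <= s)%N.
Proof.
move=> [r Pr]; apply: (epsilon_spec (inhabits 0%N)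
  (fun r => P r /\ forall s, P s -> (r <= s)%N)).
elim/ltn_ind: r Pr => r IH Pr.
case: (classic (exists2 s, P s & (s < r)%N)) => [[s Ps ltsr]|no]; first exact: IH ltsr Ps.
exists r; split=> // s Ps; rewrite leqNgt; apply/negP => ltsr; apply: no.
by exists s.
Qed.

(** * Forms, ideals and linear dependency *)

Section Forms.

Variables (n : nat) (R : nzRingType).
Implicit Types (f : {mpoly R[n]}).

Lemma homog_mdeg d f m : f \is d.-homog -> m \in msupp f -> mdeg m = d.
Proof. by move=> /dhomogP homf /homf. Qed.

Lemma homog1X f e : f \is 1.-homog -> f ^+ e \is e.-homog.
Proof. by move/(dhomogMn e); rewrite mul1n. Qed.

Lemma homog_variable i : ('X_i : {mpoly R[n]}) \is 1.-homog.
Proof. by rewrite dhomogX /= mdeg1. Qed.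

End Forms.

Section Ideal.

Variables (n : nat) (F : fieldType) (I : {mpoly F[n]} -> Prop).
Hypothesis idI : is_ideal I.
Implicit Types f g h : {mpoly F[n]}.

Lemma ideal0 : I 0. Proof. by case: idI. Qed.

Lemma idealD f g : I f -> I g -> I (f + g).
Proof. by case: idI => _ + _; apply. Qed.

Lemma idealM g f : I f -> I (g * f).
Proof. by case: idI => _ _; apply. Qed.

Lemma idealZ c f : I f -> I (c *: f).
Proof. by rewrite -mul_mpolyC; apply: idealM. Qed.

Lemma idealN f : I f -> I (- f).
Proof. by rewrite -scaleN1r; apply: idealZ. Qed.

Lemma idealB f g : I f -> I g -> I (f - g).
Proof. by move=> If /idealN; apply: idealD. Qed.

Lemma ideal_sum (J : Type) (s : seq J) (P : pred J) (f : J -> {mpoly F[n]}) :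
  (forall i, P i -> I (f i)) -> I (\sum_(i <- s | P i) f i).
Proof. by move=> If; apply: big_ind => //; [apply: ideal0 | apply: idealD]. Qed.

Lemma ideal_subl f g : I (f - g) -> I g -> I f.
Proof. by move=> Ifg Ig; rewrite -(subrK g f); apply: idealD. Qed.

Lemma ideal_subr f g : I (f - g) -> I f -> I g.
Proof. by move=> Ifg If; rewrite -(subKr f g); apply: idealB. Qed.

Lemma idealZ_neq0 c f : c != 0 -> I (c *: f) -> I f.
Proof. by move=> c0 /(idealZ c^-1); rewrite scalerA mulVf // scale1r. Qed.

Lemma colon_is_ideal f : is_ideal (fun h => I (h * f)).
Proof.
split=> [|g h Ig Ih|g h Ih]; first by rewrite mul0r; apply: ideal0.
- by rewrite mulrDl; apply: idealD.
- by rewrite -mulrA; apply: idealM.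
Qed.

(** Modulo the ideal every variable ['X_i] is [p i] times ['X_j], so a form of
    degree [e] reduces to its value at [p] times ['X_j ^+ e]. *)
Lemma ideal_eval (p : 'I_n -> F) (j : 'I_n) (e : nat) G :
  (forall i, I ('X_i - p i *: 'X_j)) -> G \is e.-homog ->
  I (G - G.@[p] *: 'X_j ^+ e).
Proof.
move=> Ip /dhomogP homG.
rewrite mevalE [X in X - _]mpolyE scaler_suml -sumrB big_seq_cond.
apply: ideal_sum => m; rewrite andbT => /homG <-.
rewrite -scalerA -scalerBr; apply: idealZ.
have -> : (\prod_i p i ^+ m i) *: 'X_j ^+ mdeg m
          = \prod_i (p i *: 'X_j) ^+ m i :> {mpoly F[n]}.
  rewrite (eq_bigr (fun i => p i ^+ m i *: 'X_j ^+ m i)) => [|i _].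
    by rewrite scaler_prod mdegE prodrXr.
  by rewrite exprZn.
rewrite mpolyXE_id.
elim/big_ind2: _ => [|a a' b b' Ia Ib|i _].
- by rewrite subrr; apply: ideal0.
- have -> : a * b - a' * b' = a * (b - b') + b' * (a - a').
    by ring.
  by apply: idealD; apply: idealM.
- by rewrite subrXX mulrC; apply: idealM.
Qed.

End Ideal.

Section Dependent.
Variables (n : nat) (F : fieldType).
Implicit Types (I : {mpoly F[n]} -> Prop).

Definition dependent_mod I (s : nat) (v : 'I_s -> {mpoly F[n]}) : Prop :=
  exists2 c : 'I_s -> F, (exists i, c i != 0) & I (\sum_i c i *: v i).

(** The coordinates of the [v i] in a basis of the quotient form a matrix with
    more rows than columns, which has a nonzero left kernel. *)
Lemma quotient_dim_dependent A I r s (v : 'I_s -> {mpoly F[n]}) :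
  is_ideal I -> quotient_dim A I r -> (forall i, A (v i)) -> (r < s)%N ->
  dependent_mod I v.
Proof.
move=> idI [b [_ basis]] Av ltrs.
have /fin_all_exists [c cP] : forall i, exists c : {ffun 'I_r -> F},
    I (v i - \sum_j c j *: b j).
  by move=> i; have [c [Ic _]] := basis _ (Av i); exists c.
pose C := \matrix_(i, j) c i j.
have : kermx C != 0.
  rewrite kermx_eq0 -row_leq_rank -ltnNge.
  exact: leq_ltn_trans (rank_leq_col C) ltrs.
case/rowV0Pn => u /sub_kermxP uC0 u0.
exists (u 0); first by case/rV0Pn: u0 => i; exists i.
apply: (ideal_subl idI (g := \sum_i u 0 i *: (\sum_j c i j *: b j))); last first.
  under eq_bigr do rewrite scaler_sumr.
  rewrite exchange_big /=; apply: ideal_sum => // j _.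
  under eq_bigr do rewrite scalerA.
  rewrite -scaler_suml.
  have /rowP/(_ j) := uC0; rewrite !mxE.
  under eq_bigr do rewrite mxE.
  by move->; rewrite scale0r; apply: ideal0.
rewrite -sumrB; apply: ideal_sum => // i _.
by rewrite -scalerBr; apply: idealZ.
Qed.

End Dependent.

(** * Points of a zero-dimensional scheme *)

Section AssociatedPoints.

Variables (n : nat) (k : closedFieldType) (I : {mpoly k[n]} -> Prop).
Hypotheses (idI : is_ideal I) (satI : is_saturated I).
Variables (r N : nat).
Hypothesis depI : forall e s (v : 'I_s -> {mpoly k[n]}),
  (N <= e)%N -> (r < s)%N -> (forall i, v i \is e.-homog) -> dependent_mod I v.
Implicit Types (f g h y z : {mpoly k[n]}) (p q : {poly k}).

(** Every form of degree 1 is a combination of variables, so membership of the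
    ['X_i * f] puts [f] in the saturation. *)
Lemma saturated_variables f : (forall i, I ('X_i * f)) -> I f.
Proof.
move=> IXf; apply: satI; exists 1%N => g /dhomogP homg.
rewrite [g]mpolyE mulr_suml big_seq_cond; apply: ideal_sum => // m.
rewrite andbT => /homg /eqP; rewrite mdeg_eq1 => /existsP[i /eqP ->].
by rewrite -scalerAl; apply: idealZ.
Qed.

(** The homogenization [y ^ m * p (z / y)] of [p] in degree [m]; a linear factor
    of [p] becomes a linear factor of the binary form, and an excess of [m] over
    the degree of [p] becomes a power of [y]. *)
Definition binary_form m (p : {poly k}) y z : {mpoly k[n]} :=
  \sum_(i < m.+1) p`_i *: (z ^+ i * y ^+ (m - i)).

Lemma binary_form_homog m p y z : y \is 1.-homog -> z \is 1.-homog ->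
  binary_form m p y z \is m.-homog.
Proof.
move=> hy hz; apply: rpred_sum => i _; apply: rpredZ.
have := dhomogM (homog1X i hz) (homog1X (m - i) hy).
by rewrite subnKC // -ltnS.
Qed.

Lemma binary_formS m p y z : (size p <= m.+1)%N ->
  binary_form m.+1 p y z = y * binary_form m p y z.
Proof.
move=> szp; rewrite /binary_form big_ord_recr /= nth_default // scale0r addr0.
rewrite mulr_sumr; apply: eq_bigr => i _.
by rewrite subSn -1?ltnS // exprS -scalerAr mulrCA.
Qed.

Lemma binary_formM m (q : {poly k}) c y z : (size q <= m.+1)%N ->
  binary_form m.+1 (q * ('X - c%:P)) y z = (z - c *: y) * binary_form m q y z.
Proof.
move=> szq; rewrite [RHS]mulrBl -scalerAl -(binary_formS y z szq).
rewrite [q * _]mulrC [('X - _) * q]mulrBl.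
have -> : z * binary_form m q y z = binary_form m.+1 ('X * q) y z.
  rewrite [RHS]/binary_form big_ord_recl /= coefXM scale0r add0r mulr_sumr.
  apply: eq_bigr => i _.
  by rewrite /= coefXM /= subSS exprS -scalerAr mulrA.
rewrite /binary_form scaler_sumr -sumrB; apply: eq_bigr => i _.
by rewrite coefB coefCM scalerBl scalerA.
Qed.

(** A binary form is a product of linear forms.  Multiplying [f] by these factors
    one at a time leads from outside [I] into [I], so some factor sends a
    multiple of [f] outside [I] into [I]. *)
Lemma pencil_splits f y z m (p : {poly k}) :
  y \is 1.-homog -> z \is 1.-homog ->
  p != 0 -> (size p <= m.+1)%N -> I (binary_form m p y z * f) -> ~ I f ->
  exists h e, [/\ h \is e.-homog, ~ I (h * f) &
    I (y * (h * f)) \/ exists c, I ((z - c *: y) * (h * f))].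
Proof.
move=> hy hz; elim: m p => [|m IH] p p0 szp Ipf If.
  case: If; have : p`_0 != 0.
    by apply: contraNneq p0 => p00; rewrite (size1_polyC szp) p00.
  move/idealZ_neq0; apply=> //.
  by move: Ipf; rewrite /binary_form big_ord1 !expr0 mulr1 -scalerAl mul1r.
have [szpm|] := leqP (size p) m.+1.
  rewrite binary_formS // -mulrA in Ipf.
  case: (classic (I (binary_form m p y z * f))) => [/IH|nI]; first exact.
  exists (binary_form m p y z), m; split=> //; first exact: binary_form_homog.
  by left.
move=> szpm; have /closed_rootP[c] : size p != 1 by rewrite gtn_eqF // (leq_trans _ szpm).
case/factor_theorem => q def_p; rewrite {p}def_p in p0 szp Ipf {szpm}.
have q0 : q != 0 by apply: contraNneq p0 => ->; rewrite mul0r.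
have szq : (size q <= m.+1)%N.
  by move: szp; rewrite size_Mmonic ?monicXsubC // size_XsubC addn2.
rewrite binary_formM // -mulrA in Ipf.
case: (classic (I (binary_form m q y z * f))) => [/IH|nI]; first exact.
exists (binary_form m q y z), m; split=> //; first exact: binary_form_homog.
by right; exists c.
Qed.

(** For large [m] the [m.+1] forms [z ^+ i * y ^+ (m - i) * f] have the same
    degree and outnumber [r]; a dependency between them is a binary form in
    [y] and [z] that kills [f] modulo [I]. *)
Lemma pencil_kills_multiple e f y z : f \is e.-homog ->
  y \is 1.-homog -> z \is 1.-homog -> ~ I f ->
  exists h e', [/\ h \is e'.-homog, ~ I (h * f) &
    I (y * (h * f)) \/ exists c, I ((z - c *: y) * (h * f))].
Proof.
move=> hf hy hz nIf; set m := maxn r N.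
have [||i|c [i ci] Ic] := @depI (m + e) m.+1 (fun i => z ^+ i * y ^+ (m - i) * f).
- by rewrite (leq_trans (leq_maxr r N)) // leq_addr.
- by rewrite ltnS leq_maxl.
- apply: dhomogM => //; have := binary_form_homog m ('X^i) hy hz.
  rewrite /binary_form (bigD1 i) //= coefXn eqxx scale1r big1 ?addr0 //.
  by move=> j /negPf; rewrite -val_eqE coefXn /= => ->; rewrite scale0r.
pose p := \poly_(j < m.+1) c (inord j).
apply: (@pencil_splits f y z m p) => //.
- apply/eqP => /polyP/(_ i); rewrite coef_poly ltn_ord inord_val coef0.
  by move/eqP; apply/negP.
- exact: size_poly.
rewrite /binary_form mulr_suml.
under eq_bigr => j _ do rewrite coef_poly ltn_ord inord_val -scalerAl.
exact: Ic.
Qed.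


(** The class of [f] in [T / I] is killed by the ideal of the point [a] of
    projective space.  The variable ['X_j] plays the role of a coordinate that
    does not vanish at [a]; when [f] is outside [I], saturation of [I] forces
    the normalization [a j = 1]. *)
Definition associated (p : 'I_n -> k) f : Prop :=
  exists j, forall i, I (('X_i - p i *: 'X_j) * f).

Implicit Types (a b : 'I_n -> k).

Lemma associatedM a h f : associated a f -> associated a (h * f).
Proof.
by move=> [j aj]; exists j => i; rewrite mulrCA; apply: idealM.
Qed.

Lemma associated_variable a f : associated a f -> ~ I f ->
  exists j, [/\ forall i, I (('X_i - a i *: 'X_j) * f), a j = 1 &
                forall e, ~ I ('X_j ^+ e * f)].
Proof.
move=> [j aj] nIf; exists j; split=> //.
  apply/eqP; rewrite -subr_eq0 -opprB oppr_eq0; apply: contra_notT nIf => a1.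
  have := aj j; rewrite -{1}['X_j]scale1r -scalerBl -scalerAl.
  move=> /(idealZ_neq0 idI a1) Ij.
  apply: saturated_variables => i.
  apply: (ideal_subl idI (g := a i *: ('X_j * f))); last exact: idealZ.
  by rewrite scalerAl -mulrBl.
elim=> [|e IH]; first by rewrite mul1r.
rewrite exprS -mulrA; apply: contra_not IH => Ij.
apply: saturated_variables => i.
apply: (ideal_subl idI (g := a i *: ('X_j * ('X_j ^+ e * f)))); last exact: idealZ.
by rewrite scalerAl -mulrBl mulrCA; apply: idealM.
Qed.

(** The submodule of [T / I] generated by [f] is the coordinate ring of the
    point [a], up to a shift: a form kills [f] exactly when it vanishes at
    [a]. *)
Lemma associated_eval a f e G : associated a f -> ~ I f -> G \is e.-homog ->
  I (G * f) <-> G.@[a] = 0.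
Proof.
move=> af nIf hG; have [j [aj _ Ij]] := associated_variable af nIf.
have := ideal_eval (colon_is_ideal idI f) aj hG; rewrite mulrBl -scalerAl => IG.
split=> [If|Ga0]; last first.
  by apply: ideal_subl IG _ => //; rewrite Ga0 scale0r; apply: ideal0.
have [//|Ga0] := eqVneq G.@[a] 0.
by case: (Ij e); apply: idealZ_neq0 Ga0 _ => //; apply: ideal_subr IG If.
Qed.

(** The variables are treated one after the other, replacing [f] by a multiple.
    When ['X_i] is added while ['X_j] is the current reference coordinate, the
    pencil of ['X_j] and ['X_i] kills a multiple of [f].  Either ['X_i] becomes a
    scalar multiple of ['X_j], or ['X_j] is killed; in the latter case so are all
    earlier variables, and ['X_i] is the new reference coordinate. *)
Lemma exists_associated_multiple e f : f \is e.-homog -> ~ I f ->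
  exists h e' a, [/\ h \is e'.-homog, ~ I (h * f) & associated a (h * f)].
Proof.
move=> hf nIf.
suff step (s : seq 'I_n) : exists h e' (a : 'I_n -> k) j,
    [/\ h \is e'.-homog, ~ I (h * f) &
        forall i, i \in s -> I (('X_i - a i *: 'X_j) * (h * f))].
  have [h [e' [a [j [hh nIh Ia]]]]] := step (enum 'I_n).
  by exists h, e', a; split=> //; exists j => i; apply: Ia; rewrite mem_enum.
elim: s => [|i s [h [e1 [a [j [hh nIh Ia]]]]]].
  case: (pickP 'I_n) => [j _|no].
    exists 1, 0%N, (fun=> 0), j; split=> //; first exact: dhomog1.
    by rewrite mul1r.
  by case: nIf; apply: saturated_variables => i; have := no i.
have [h' [e2 [hh' nIh' kills]]] := pencil_kills_multiple
  (dhomogM hh hf) (homog_variable k j) (homog_variable k i) nIh.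
exists (h' * h), (e2 + e1)%N.
have Ia' i' : i' \in s -> I (('X_i' - a i' *: 'X_j) * (h' * (h * f))).
  by move=> /Ia Ii'; rewrite mulrCA; apply: idealM.
case: kills => [Ij|[c Ic]].
  exists (fun i' => (i' == i)%:R), i; rewrite dhomogM // -mulrA; split=> // i'.
  rewrite in_cons; case: eqVneq => [-> _|nei /= /Ia' Ii'].
    by rewrite scale1r subrr mul0r; apply: ideal0.
  rewrite scale0r subr0; apply: (ideal_subl idI (g := a i' *: ('X_j * (h' * (h * f))))).
    by rewrite scalerAl -mulrBl.
  exact: idealZ.
exists (fun i' => if i' == i then c else a i'), j.
rewrite dhomogM // -mulrA; split=> // i'.
by rewrite in_cons; case: eqVneq => [-> _|nei /= /Ia'].
Qed.

Section Avoidance.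

Variables (delta : nat) (L : {mpoly k[n]} -> Prop).
Hypothesis L0 : L 0.
Hypothesis L_lin : forall c f g, L f -> L g -> L (f + c *: g).
Hypothesis L_homog : forall f, L f -> f \is delta.-homog.
Hypothesis L_basepoint_free : forall a,
  (exists j, a j = 1) -> exists2 g, L g & g.@[a] != 0.

(** The forms of [L] vanishing at one given point make up a proper subspace, and
    a vector space over an infinite field is not a finite union of these: a
    general member of the pencil [g + c *: g'] avoids all the points. *)
Lemma avoid_points s (a : 'I_s -> 'I_n -> k) :
  (forall i, exists j, a i j = 1) ->
  exists2 g, L g & forall i, g.@[a i] != 0.
Proof.
elim: s a => [|s IH] a a1; first by exists 0 => // -[].
have [g Lg ga] := IH (fun i => a (lift ord0 i)) (fun i => a1 (lift ord0 i)).
have [g' Lg' g'a] := L_basepoint_free (a1 ord0).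
have /closed_nonrootP[c] : \prod_i (g.@[a i]%:P + g'.@[a i] *: 'X) != 0 :> {poly k}.
  apply/prodf_neq0 => i _; apply/eqP => /polyP coef0s.
  have := coef0s 0%N; have := coef0s 1%N.
  rewrite !coefE /= !mulr1 !mulr0 !addr0 add0r => g'0 g0.
  case: (unliftP ord0 i) => [i' def_i|def_i]; rewrite def_i in g0 g'0.
    by have /eqP := ga i'.
  by have /eqP := g'a.
rewrite rootE horner_prod => /prodf_neq0 nz; exists (g + c *: g'); first exact: L_lin.
by move=> i; have := nz i isT; rewrite !hornerE mevalD mevalZ mulrC.
Qed.

(** The submodules of [T / I] that consist of the elements associated with the
    points [a i] are in direct sum. *)
Definition separated s (a : 'I_s -> 'I_n -> k) : Prop :=
  forall f : 'I_s -> {mpoly k[n]}, (forall i, associated (a i) (f i)) ->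
  I (\sum_i f i) -> forall i, I (f i).

(** Multiplication by [g] kills the component at [b] and is injective on the
    components at the [a i]. *)
Lemma separatedS s (a : 'I_s -> 'I_n -> k) b g e : separated a ->
  g \is e.-homog -> (forall i, g.@[a i] != 0) -> g.@[b] = 0 ->
  separated (fun i : 'I_s.+1 => oapp a b (unlift ord0 i)).
Proof.
move=> sep_a hg ga gb f af; rewrite big_ord_recl => If.
have Igb : I (g * f ord0).
  case: (classic (I (f ord0))) => [|nIf]; first exact: idealM.
  have bf : associated b (f ord0) by have := af ord0; rewrite unlift_none.
  exact/(associated_eval bf nIf hg).
have Ilift i : I (f (lift ord0 i)).
  have afi : associated (a i) (f (lift ord0 i)).
    by have := af (lift ord0 i); rewrite liftK.
  apply: NNPP => nIf; have /eqP[] := ga i; apply/(associated_eval afi nIf hg).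
  move: i {afi nIf}; apply: sep_a => [i|].
    by apply: associatedM; have := af (lift ord0 i); rewrite liftK.
  rewrite -mulr_sumr; apply: (ideal_subr idI (f := g * (f ord0 + \sum_i f (lift ord0 i)))).
    by rewrite mulrDr addrK.
  exact: idealM.
move=> i; case: (unliftP ord0 i) => [i' ->|->]; first exact: Ilift.
apply: (ideal_subl idI (g := - \sum_i f (lift ord0 i))).
  by rewrite opprK.
by apply: idealN => //; apply: ideal_sum.
Qed.

(** If no form of [L] is regular, points can be added forever: a form of [L] that
    avoids the previous points kills some form outside [I], hence vanishes at an
    associated point of it.  Eigenvectors at [r.+1] points, brought to a common
    degree, are dependent modulo [I], whereas they are separated. *)
Lemma exists_regular_form :
  exists2 g, L g & forall e f, f \is e.-homog -> I (g * f) -> I f.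
Proof.
apply: NNPP => noreg.
have step s : exists a : 'I_s -> 'I_n -> k, separated a /\
  forall i, exists f e, [/\ f \is e.-homog, ~ I f & associated (a i) f].
  elim: s => [|s [a [sep_a fa]]]; first by exists (fun=> fun=> 0); split=> [f _ _|] [].
  have [i|g Lg ga] := @avoid_points s a.
    have [f [e [_ nIf af]]] := fa i.
    by have [j [_ aj _]] := associated_variable af nIf; exists j.
  have [f [e [hf Igf nIf]]] : exists f e, [/\ f \is e.-homog, I (g * f) & ~ I f].
    apply: NNPP => nof; apply: noreg; exists g => // e f hf Igf.
    by apply: NNPP => nIf; apply: nof; exists f, e.
  have [h [e' [b [hh nIhf bhf]]]] := exists_associated_multiple hf nIf.
  exists (fun i => oapp a b (unlift ord0 i)); split.
    apply: (separatedS sep_a (L_homog Lg) ga).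
    apply/(associated_eval bhf nIhf (L_homog Lg)).
    by rewrite mulrCA; apply: idealM.
  move=> i; case: (unliftP ord0 i) => [i' _|_] /=; first exact: fa.
  by exists (h * f), (e' + e)%N; rewrite dhomogM.
have [a [sep_a /fin_all_exists[f /fin_all_exists[e fe]]]] := step r.+1.
pose E := (N + \sum_i e i)%N.
have /fin_all_exists[v vP] : forall i, exists v,
    [/\ v \is E.-homog, ~ I v & associated (a i) v].
  move=> i; have [hf nIf af] := fe i.
  have [j [_ _ nIj]] := associated_variable af nIf.
  exists ('X_j ^+ (E - e i) * f i); split=> //; last exact: associatedM.
  have := dhomogM (homog1X (E - e i) (homog_variable k j)) hf.
  by rewrite subnK // /E (bigD1 i) //= addnCA leq_addr.
have [||i|c [i ci] Ic] := @depI E r.+1 v; rewrite ?leq_addr //.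
  by case: (vP i).
have [_ nIv _] := vP i; case: nIv; apply: (idealZ_neq0 idI ci).
move: i {ci}; apply: sep_a => // i.
by rewrite -mul_mpolyC; apply: associatedM; case: (vP i).
Qed.

End Avoidance.

End AssociatedPoints.

(** * The action of differential operators *)

Section DifferentialAction.

Variables (n : nat) (F : fieldType).
Implicit Types (f g h Theta Phi : {mpoly F[n]}) (m : 'X_{1..n}) (a : 'I_n -> F).

Lemma diff_actwE K Theta f : (msize Theta <= K)%N ->
  diff_act Theta f = \sum_(m : 'X_{1..n < K}) Theta@_m *: f^`M[m].
Proof.
move=> leK; rewrite /diff_act (big_mksub 'X_{1..n < K}) /=; first last.
- by move=> m /msize_mdeg_lt /leq_trans; apply.
- exact: msupp_uniq.
by rewrite big_rmcond //= => m /memN_msupp_eq0 ->; rewrite scale0r.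
Qed.

Lemma diff_act_linearl f : linear (fun Theta => diff_act Theta f).
Proof.
move=> c Theta Phi; pose_big_enough K.
  rewrite !(@diff_actwE K) // scaler_sumr -big_split /=; apply: eq_bigr => m _.
  by rewrite linearP /= scalerDl scalerA.
by close.
Qed.

Lemma diff_act_linear Theta : linear (diff_act Theta).
Proof.
move=> c f g; rewrite /diff_act scaler_sumr -big_split /=; apply: eq_bigr => m _.
by rewrite linearP /= scalerDr !scalerA mulrC.
Qed.

HB.instance Definition _ Theta :=
  GRing.isLinear.Build F {mpoly F[n]} {mpoly F[n]} _ (diff_act Theta)
    (diff_act_linear Theta).

(** [diff_act] with its arguments exchanged, so that linearity in the operator
    can be registered as an instance. *)
Definition apply_to f Theta := diff_act Theta f.

HB.instance Definition _ f :=
  GRing.isLinear.Build F {mpoly F[n]} {mpoly F[n]} _ (apply_to f)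
    (diff_act_linearl f).

Lemma diff_actX m f : diff_act 'X_[m] f = f^`M[m].
Proof. by rewrite /diff_act msuppX big_seq1 mcoeffX eqxx scale1r. Qed.

(** Composition of differential operators: this is what makes [perp W] an
    ideal. *)
Lemma diff_actM Theta Phi f :
  diff_act (Theta * Phi) f = diff_act Theta (diff_act Phi f).
Proof.
have XM m Psi : diff_act ('X_[m] * Psi) f = (diff_act Psi f)^`M[m].
  rewrite {1}[Psi]mpolyE mulr_sumr -/(apply_to f _) linear_sum /= linear_sum.
  apply: eq_bigr => m' _; rewrite -scalerAr -mpolyXD !linearZ /=.
  by rewrite /apply_to diff_actX addmC mderivmDm.
rewrite {1}[Theta]mpolyE mulr_suml -/(apply_to f _) linear_sum /=.
by apply: eq_bigr => m _; rewrite -scalerAl linearZ /= /apply_to XM.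
Qed.

Lemma perp_is_ideal (W : {pred {mpoly F[n]}}) : is_ideal (perp W).
Proof.
split=> [f _|Theta Phi IT IP f fW|Phi Theta IT f fW].
- by rewrite -/(apply_to f _) linear0.
- by rewrite -/(apply_to f _) linearD /= /apply_to IT // IP // addr0.
- by rewrite diff_actM IT // linear0.
Qed.

(** Each monomial of [f] has a smaller exponent than [m] in some variable, which
    makes one of the falling factorials vanish. *)
Lemma mderivm_eq0 d m f : f \is d.-homog -> (d < mdeg m)%N -> f^`M[m] = 0.
Proof.
move=> homf ltd; rewrite mderivmE big_seq big1 // => m' /(homog_mdeg homf) degm'.
have /existsP[i lti] : [exists i, m' i < m i]%N.
  apply: contraLR ltd; rewrite negb_exists => /forallP lem.
  rewrite -leqNgt -degm' !mdegE; apply: leq_sum => i _.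
  by rewrite leqNgt.
by rewrite (bigD1 i) //= ffact_small // mul0n mulr0 scale0r.
Qed.

Lemma diff_act_eq0 d e Theta f : Theta \is e.-homog -> f \is d.-homog ->
  (d < e)%N -> diff_act Theta f = 0.
Proof.
move=> homT homf ltde.
rewrite /diff_act big_seq big1 // => m /(homog_mdeg homT) dm.
by rewrite (mderivm_eq0 homf) ?scaler0 // dm.
Qed.

Definition linear_form a : {mpoly F[n]} := \sum_i a i *: 'X_i.

Lemma linear_formE f : f \is 1.-homog -> f = linear_form (fun i => f@_U_(i)).
Proof.
move=> homf; apply/mpolyP => m.
have [/eqP/mdeg1P[i /eqP ->]|/eqP degm] := eqVneq (mdeg m) 1%N.
  rewrite linear_sum (bigD1 i) //= mcoeffZ mcoeffX eqxx mulr1 big1 ?addr0 //.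
  by move=> j /negPf neq; rewrite mcoeffZ mcoeffXU neq mulr0.
rewrite (dhomog_nemf_coeff homf); last exact/eqP.
rewrite /linear_form raddf_sum /= big1 // => i _; rewrite mcoeffZ mcoeffX.
by case: eqVneq degm => [<-|_ _]; rewrite ?mdeg1 ?mulr0.
Qed.

Lemma mderiv_linear_form a i : (linear_form a)^`M(i) = (a i)%:MP.
Proof.
rewrite linear_sum (bigD1 i) //= mderivZ mderivX mnm1E eqxx scale1r.
have -> : (U_(i) - U_(i) = 0 :> 'X_{1..n})%MM.
  by apply/mnmP => j; rewrite mnmBE subnn mnm0E.
rewrite mpolyX0 big1 ?addr0 => [|j neq].
  by rewrite -mul_mpolyC mulr1.
by rewrite mderivZ mderivX mnm1E (negPf neq) scale0r scaler0.
Qed.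

Lemma mderivXn f i e : (f ^+ e)^`M(i) = e%:R *: (f^`M(i) * f ^+ e.-1).
Proof.
elim: e => [|[|e] IH]; first by rewrite expr0 -mpolyC1 mderivC scale0r.
  by rewrite expr1 scale1r mulr1.
rewrite exprS mderivM IH -scalerAr mulrCA -exprS /=.
by rewrite [in RHS]mulrS scalerDl scale1r.
Qed.

Lemma mderivm_linear_form_pow a m d :
  (linear_form a ^+ d)^`M[m]
    = ((d ^_ (mdeg m))%:R * \prod_i a i ^+ m i) *: linear_form a ^+ (d - mdeg m).
Proof.
move: {2}(mdeg m) (erefl (mdeg m)) => e.
elim: e m => [|e IH] m degm.
  move/eqP: (degm); rewrite mdeg_eq0 => /eqP ->.
  rewrite mderivm0m mdeg0 ffactn0 subn0 big1 ?mulr1 ?scale1r // => i _.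
  by rewrite mnm0E.
have /existsP[i mi] : [exists i, 0 < m i]%N.
  apply: contraPT degm; rewrite negb_exists => /forallP m0.
  by rewrite mdegE big1 // => i _; have := m0 i; case: (m i).
have le1m : (U_(i) <= m)%MM by rewrite lep1mP -lt0n.
have def_m := submK le1m; have degm' : mdeg (m - U_(i)) = e.
  by move: degm; rewrite -{1}def_m mdegD mdeg1 addn1 => -[].
rewrite -def_m mderivmDm mderivmU1m IH // mderivZ mderivXn.
rewrite mderiv_linear_form mul_mpolyC !scalerA mdegD mdeg1 degm' addn1.
rewrite -subnS; congr (_ *: _); rewrite ffactnSr natrM.
have -> : \prod_i0 a i0 ^+ (m - U_(i) + U_(i))%MM i0
        = (\prod_i0 a i0 ^+ (m - U_(i))%MM i0) * a i.
  under eq_bigr => j _ do rewrite mnmDE exprD.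
  rewrite big_split /=; congr (_ * _).
  rewrite (bigD1 i) //= mnm1E eqxx expr1 big1 ?mulr1 // => j neq.
  by rewrite mnm1E eq_sym (negPf neq).
by rewrite !mulrA [in RHS](mulrAC _ (d - e)%:R).
Qed.

(** The apolarity lemma: a form of degree [e] acts on a power of a linear form by
    evaluation at the corresponding point. *)
Lemma diff_act_linear_form_pow a d e Theta : Theta \is e.-homog ->
  diff_act Theta (linear_form a ^+ d)
    = ((d ^_ e)%:R * Theta.@[a]) *: linear_form a ^+ (d - e).
Proof.
move=> homT; rewrite /diff_act mevalE mulr_sumr scaler_suml.
apply: eq_big_seq => m /(homog_mdeg homT) degm; rewrite mderivm_linear_form_pow degm scalerA.
by rewrite mulrCA.
Qed.

End DifferentialAction.

(** * Bounding the length of a quotient *)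

Section Length.

Variables (n : nat) (F : fieldType).
Implicit Types (f g : {mpoly F[n]}) (I P : {mpoly F[n]} -> Prop).

(** A family of forms of maximal size among those independent modulo [P] spans
    all forms, hence all polynomials. *)
Lemma quotient_dim_le P b : is_ideal P ->
  (forall s (v : 'I_s -> {mpoly F[n]}) (e : 'I_s -> nat),
     (forall i, v i \is (e i).-homog) -> (b < s)%N -> dependent_mod P v) ->
  exists2 a, (a <= b)%N & quotient_dim (fun _ => True) P a.
Proof.
move=> idP depP.
pose Q s := exists (v : 'I_s -> {mpoly F[n]}) (e : 'I_s -> nat),
  (forall i, v i \is (e i).-homog) /\ ~ dependent_mod P v.
have Qb s : Q s -> (s <= b)%N.
  move=> [v [e [hv indep]]]; rewrite leqNgt; apply/negP => ltbs.
  exact: indep (depP _ _ _ hv ltbs).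
have [a Qa QSa] : exists2 s, Q s & ~ Q s.+1.
  apply: NNPP => noQ.
  have Qs s : Q s.
    elim: s => [|s Qs]; last by apply: NNPP => nQ; apply: noQ; exists s.
    by exists (fun=> 0), (fun=> 0%N); split=> [|[c []]] [].
  by have := Qb _ (Qs b.+1); rewrite ltnn.
exists a; first exact: Qb.
have [v [e [hv indep]]] := Qa; exists v; split=> // f _.
have span_homog e' h : h \is e'.-homog ->
    exists c : 'I_a -> F, P (h - \sum_i c i *: v i).
  move=> hh; pose w (i : 'I_a.+1) := oapp v h (unlift ord0 i).
  have /NNPP [c [i ci] Pc] : ~ ~ dependent_mod P w.
    move=> indep'; apply: QSa; exists w, (fun i => oapp e e' (unlift ord0 i)).
    by split=> // i'; rewrite /w; case: (unliftP ord0 i') => [i'' _|_] /=.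
  move: Pc; rewrite big_ord_recl /w unlift_none /=.
  under eq_bigr do rewrite liftK /=.
  have [c0|c0] := eqVneq (c ord0) 0.
    rewrite c0 scale0r add0r => Pc; case: indep; exists (fun i => c (lift ord0 i)) => //.
    by case: (unliftP ord0 i) ci => [i' -> ci|->]; [exists i'|rewrite c0 eqxx].
  move=> Pc; exists (fun i => - (c ord0)^-1 * c (lift ord0 i)).
  apply: (idealZ_neq0 idP c0); rewrite scalerBr scaler_sumr -sumrN.
  under eq_bigr do rewrite scalerA mulrA mulrN divff // mulN1r scaleNr opprK.
  exact: Pc.
have [c Pc] : exists c : 'I_a -> F, P (f - \sum_i c i *: v i).
  rewrite (pihomog_partitionE (leqnn (msize f))).
  elim/big_ind: _ => [|g h [c Pc] [c' Pc']|i _].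
  - exists (fun=> 0); rewrite big1 ?subrr => [|i _]; last by rewrite scale0r.
    exact: ideal0.
  - exists (fun i => c i + c' i).
    under eq_bigr do rewrite scalerDl.
    by rewrite big_split /= opprD addrACA; apply: idealD.
  - exact: span_homog (pihomogP _ _ _).
exists (finfun c); split=> [|c' Pc'].
  by under eq_bigr do rewrite ffunE.
apply/ffunP => i; rewrite ffunE; apply/eqP; rewrite -subr_eq0.
apply: contra_notT indep => ci; exists (fun i => c i - c' i); first by exists i.
under eq_bigr do rewrite scalerBl.
rewrite sumrB; have := idealB idP Pc' Pc; congr P.
by rewrite opprB addrC addrA subrK.
Qed.

Lemma dependent_on_set I r s (v : 'I_s -> {mpoly F[n]}) (B : {set 'I_s}) :
  (forall v' : 'I_#|B| -> {mpoly F[n]},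
     (forall q, exists2 i, i \in B & v' q = v i) -> dependent_mod I v') ->
  (r < #|B|)%N ->
  exists2 c : 'I_s -> F, (exists2 i, i \in B & c i != 0) & I (\sum_(i in B) c i *: v i).
Proof.
move=> dep /(leq_ltn_trans (leq0n r))/card_gt0P[i0 Bi0].
have [|c [q cq] Ic] := dep (fun q => v (enum_val q)).
  by move=> q; exists (enum_val q) => //; apply: enum_valP.
exists (fun i => c (enum_rank_in Bi0 i)).
  by exists (enum_val q); rewrite ?enum_valP // enum_valK_in.
by rewrite big_enum_val; under eq_bigr do rewrite enum_valK_in.
Qed.

Lemma pigeonhole_fibre s delta r (t : 'I_s -> 'I_delta) : (delta * r < s)%N ->
  exists q, (r < #|[set i | t i == q]|)%N.
Proof.
move=> lts; apply/existsP; apply: contraLR lts; rewrite negb_exists => /forallP ler.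
rewrite -leqNgt -[s]card_ord -sum1_card (partition_big t predT) //=.
rewrite -[delta in (_ <= delta * _)%N]card_ord -sum_nat_const; apply: leq_sum => q _.
by rewrite sum1dep_card leqNgt ler.
Qed.

(** With [g] regular on [T / I], each form is multiplied by the power [j i] of [g]
    that brings its degree into the window from [E] to [E + delta - 1].  By the
    pigeonhole principle more than [r] products share a degree and are dependent
    modulo [I].  The smallest power of [g] occurring with a nonzero coefficient
    can be cancelled; the terms still divisible by [g] then lie in [P], and the
    others form a dependency between the given forms. *)
Lemma forms_dependent I P r N delta g : is_ideal I -> is_ideal P ->
  (forall f, I f -> P f) -> P g -> g \is delta.-homog -> (0 < delta)%N ->
  (forall e f, f \is e.-homog -> I (g * f) -> I f) ->
  (forall e s (v : 'I_s -> {mpoly F[n]}), (N <= e)%N -> (r < s)%N ->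
     (forall i, v i \is e.-homog) -> dependent_mod I v) ->
  forall s (v : 'I_s -> {mpoly F[n]}) (e : 'I_s -> nat),
     (forall i, v i \is (e i).-homog) -> (delta * r < s)%N -> dependent_mod P v.
Proof.
move=> idI idP IP Pg hg delta0 reg depI s v e hv lts.
pose E := (N + \sum_i e i)%N.
(* Rounding up, so that the degree [u i] reached is at least [E]. *)
pose j i := ((E - e i + delta.-1) %/ delta)%N.
pose u i := (j i * delta + e i)%N.
have leE i : (e i <= E)%N by rewrite /E (bigD1 i) //= addnCA leq_addr.
have Eu i : (E <= u i < E + delta)%N.
  have := divn_eq (E - e i + delta.-1) delta.
  have := ltn_pmod (E - e i + delta.-1) delta0.
  rewrite -/(j i) /u; have := leE i; move: delta0; lia.
have t_subproof i : (u i - E < delta)%N by have := Eu i; lia.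
have [q] := pigeonhole_fibre (fun i => Ordinal (t_subproof i)) lts.
set B := [set i | _] => ltr.
have uB i : i \in B -> u i = (E + q)%N.
  by rewrite inE => /eqP <- /=; have := Eu i; lia.
have [v' v'P|c [i0 Bi0 ci0] Ic] :=
    dependent_on_set (I := I) (v := fun i => g ^+ j i * v i) _ ltr.
  apply: (depI (E + q)%N) => //; first by rewrite /E -addnA leq_addr.
  move=> q'; have [i Bi ->] := v'P q'; rewrite -(uB i Bi) /u mulnC.
  by apply: dhomogM => //; apply: dhomogMn.
have [i1 /andP[Bi1 ci1] min_i1] := @arg_minnP _ i0 (fun i => (i \in B) && (c i != 0)) j
  (introT andP (conj Bi0 ci0)).
have regX l e' f : f \is e'.-homog -> I (g ^+ l * f) -> I f.
  move=> hf; elim: l => [|l IH]; first by rewrite mul1r.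
  rewrite exprS -mulrA => /reg; move/(_ (delta * l + e')%N) => regl.
  by apply/IH/regl/dhomogM => //; apply: dhomogMn.
have PS : P (\sum_(i in B) c i *: (g ^+ (j i - j i1) * v i)).
  apply/IP/(regX (j i1) (E + q - j i1 * delta)%N).
    apply: rpred_sum => i Bi; have [->|ci] := eqVneq (c i) 0.
      by rewrite scale0r rpred0.
    apply: rpredZ; rewrite -(uB _ Bi) /u -addnBAC ?leq_mul2r ?min_i1 ?Bi ?orbT //.
    by rewrite -mulnBl mulnC; apply: dhomogM => //; apply: dhomogMn.
  move: Ic; rewrite mulr_sumr; congr I; apply: eq_bigr => i Bi.
  have [->|ci] := eqVneq (c i) 0; first by rewrite !scale0r mulr0.
  by rewrite -scalerAr mulrA -exprD subnKC // min_i1 // Bi.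
exists (fun i => if (i \in B) && (j i == j i1) then c i else 0).
  by exists i1; rewrite Bi1 eqxx.
have := PS; rewrite (bigID (fun i => j i == j i1)) /= => PD.
rewrite (bigID (fun i => (i \in B) && (j i == j i1))) /= [X in _ + X]big1 ?addr0; last first.
  by move=> i /negPf ->; rewrite scale0r.
rewrite (eq_bigr (fun i => c i *: v i)) => [|i ->] //.
have PB : P (\sum_(i in B | j i != j i1) c i *: (g ^+ (j i - j i1) * v i)).
  apply: ideal_sum => // i /andP[Bi nej].
  have [->|ci] := eqVneq (c i) 0; first by rewrite scale0r; apply: ideal0.
  apply: idealZ => //; have : (0 < j i - j i1)%N.
    by rewrite subn_gt0 ltn_neqAle eq_sym nej min_i1 // Bi.
  case: (j i - j i1)%N => // l _; rewrite exprSr mulrAC.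
  exact: idealM.
move: (idealB idP PD PB); rewrite addrK; congr P.
by apply: eq_bigr => i /andP[_ /eqP->]; rewrite subnn mul1r.
Qed.

End Length.

(** * Ideals of points *)

Section Lines.

Variables (n : nat) (R : comNzRingType).
Implicit Types (f g : {mpoly R[n]}) (a : 'I_n -> R).

(** Restriction to the line spanned by [a], as a polynomial in a parameter: its
    kernel is the homogeneous prime ideal of the point [a] of projective space,
    because the coefficient of degree [e] is the value at [a] of the homogeneous
    component of degree [e]. *)
Definition restrict_line a f : {poly R} := mmap polyC (fun i => a i *: 'X) f.

HB.instance Definition _ a := GRing.RMorphism.copy (restrict_line a)
  (mmap polyC (fun i => a i *: 'X)).

Lemma restrict_lineZ a c f : restrict_line a (c *: f) = c *: restrict_line a f.
Proof. by rewrite /restrict_line mmapZ mul_polyC. Qed.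

Lemma restrict_lineX a m :
  restrict_line a 'X_[m] = 'X_[m].@[a] *: 'X^(mdeg m).
Proof.
rewrite /restrict_line mmapX mevalX mdegE -prodrXr -scaler_prod.
by apply: eq_bigr => i _; rewrite exprZn.
Qed.

Lemma restrict_line_homog a e f : f \is e.-homog ->
  restrict_line a f = f.@[a] *: 'X^e.
Proof.
move=> homf; rewrite [f]mpolyE !raddf_sum scaler_suml /= !big_seq.
apply: eq_bigr => m /(homog_mdeg homf) degm.
by rewrite restrict_lineZ restrict_lineX degm mevalZ scalerA.
Qed.

Lemma restrict_line_var a i : restrict_line a 'X_i = a i *: 'X.
Proof. by rewrite restrict_lineX mevalXU mdeg1. Qed.

Lemma coef_restrict_line a e f :
  (restrict_line a f)`_e = (pihomog mdeg e f).@[a].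
Proof.
rewrite {1}[f]mpolyE raddf_sum coef_sum pihomogE raddf_sum [RHS]big_mkcond /=.
apply: eq_bigr => m _; rewrite restrict_lineZ restrict_lineX !coefZ coefXn mevalZ.
by rewrite eq_sym; case: eqP; rewrite ?mulr1 ?mulr0.
Qed.

End Lines.

Lemma map_restrict_line n (R S : comNzRingType) (phi : {rmorphism R -> S})
    (a : 'I_n -> R) (f : {mpoly R[n]}) :
  map_poly phi (restrict_line a f) = restrict_line (phi \o a) (map_mpoly phi f).
Proof.
elim/mpolyind: f => [|c m f _ _ IH]; first by rewrite !raddf0.
rewrite !rmorphD /= IH; congr (_ + _).
rewrite map_mpolyZ map_mpolyX !restrict_lineZ !restrict_lineX !map_polyZ map_polyXn.
by rewrite !mevalX rmorph_prod; under [in RHS]eq_bigr do rewrite /= -rmorphXn.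
Qed.

Lemma eq_restrict_line n (R : comNzRingType) (a b : 'I_n -> R) f :
  a =1 b -> restrict_line a f = restrict_line b f.
Proof.
by move=> eqab; apply/polyP => e; rewrite !coef_restrict_line (meval_eq _ eqab).
Qed.

Section PointsIdeal.

Variables (n : nat) (F : fieldType).
Implicit Types (f g : {mpoly F[n]}).

Definition points_ideal r (p : 'I_r -> 'I_n -> F) f : Prop :=
  forall i, restrict_line (p i) f = 0.

(** Nonzero and pairwise non-proportional vectors.  Non-proportionality is
    expressed by a minor so that it is visibly preserved by field extensions. *)
Definition distinct_points r (p : 'I_r -> 'I_n -> F) : Prop :=
  (forall i, exists s, p i s != 0) /\
  (forall i j, i != j -> exists s t, p i s * p j t != p i t * p j s).

Section Fixed.
Variables (r : nat) (p : 'I_r -> 'I_n -> F).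
Hypothesis distinct_p : distinct_points p.

Lemma points_ideal_is_ideal : is_ideal (points_ideal p).
Proof.
split=> [i|f g If Ig i|g f If i]; first by rewrite rmorph0.
- by rewrite rmorphD /= If Ig addr0.
- by rewrite rmorphM /= If mulr0.
Qed.

Lemma points_ideal_homogeneous : is_homogeneous (points_ideal p).
Proof.
move=> f If e i; rewrite (restrict_line_homog _ (pihomogP _ _ _)).
by rewrite -coef_restrict_line If coef0 scale0r.
Qed.

Lemma points_ideal_homogP e f : f \is e.-homog ->
  points_ideal p f <-> forall i, f.@[p i] = 0.
Proof.
move=> homf; split=> If i; have := If i; last first.
  by rewrite (restrict_line_homog _ homf) => ->; rewrite scale0r.
rewrite (restrict_line_homog _ homf) => /eqP.
by rewrite scaler_eq0 expf_eq0 polyX_eq0 andbF orbF => /eqP.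
Qed.

Lemma points_ideal_saturated : is_saturated (points_ideal p).
Proof.
move=> f [N IN] i; have [s ps] := distinct_p.1 i.
have := IN ('X_s ^+ N) (homog1X N (homog_variable F s)) i.
rewrite rmorphM rmorphXn /= restrict_line_var => /eqP.
rewrite mulf_eq0 expf_eq0 scaler_eq0 (negPf ps) polyX_eq0 andbF /=.
by move/eqP.
Qed.

Lemma points_ideal_radical : is_radical (points_ideal p).
Proof.
move=> f m If i; have /eqP := If i.
by rewrite rmorphXn expf_eq0 => /andP[_ /eqP].
Qed.

(** Since [p i] and [p j] are not proportional, some linear form vanishes at [p j]
    and not at [p i].  The product of these forms over [j], padded by a power of
    a variable that is nonzero at [p i], has degree [e]. *)
Lemma interpolation e i : (r <= e)%N ->
  exists2 g, g \is e.-homog & forall j, g.@[p j] = (i == j)%:R.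
Proof.
move=> lere.
have /fin_all_exists[l lP] : forall j, exists l : {mpoly F[n]},
    [/\ l \is 1.-homog, l.@[p i] != 0 & j != i -> l.@[p j] = 0].
  move=> j; have [->|neij] := eqVneq j i.
    have [s ps] := distinct_p.1 i; exists 'X_s; rewrite mevalXU; split=> //.
    exact: homog_variable.
  rewrite eq_sym in neij; have [s [t st]] := distinct_p.2 i j neij.
  exists (p j t *: 'X_s - p j s *: 'X_t); rewrite !mevalB !mevalZ !mevalXU.
  split=> [||_]; first by rewrite rpredB ?rpredZ ?homog_variable.
    by rewrite subr_eq0 mulrC [p j s * _]mulrC.
  by rewrite mulrC subrr.
have [s ps] := distinct_p.1 i.
pose g := 'X_s ^+ (e - r) * \prod_j l j.
have hg : g \is e.-homog.
  rewrite -[e](subnK lere); apply: dhomogM; first exact/homog1X/homog_variable.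
  rewrite -[r in r.-homog]card_ord -sum1_card.
  elim/big_rec2: _ => [|j d x _]; first exact: dhomog1.
  by move=> hx; apply: dhomogM => //; case: (lP j).
have gi : g.@[p i] != 0.
  rewrite mevalM rmorphXn rmorph_prod /= mevalXU mulf_neq0 ?expf_neq0 //.
  by apply/prodf_neq0 => j _; case: (lP j).
have gj j : j != i -> g.@[p j] = 0.
  move=> nji; rewrite mevalM rmorph_prod (bigD1 j) //=.
  by case: (lP j) => _ _ -> //; rewrite mul0r mulr0.
exists ((g.@[p i])^-1 *: g) => [|j]; first exact: rpredZ.
rewrite mevalZ; case: eqVneq => [<-|neij]; first by rewrite mulVf.
by rewrite (gj j) ?mulr0 // eq_sym.
Qed.

(** Evaluation at the points identifies the forms of large degree modulo the
    ideal with functions on the set of points; it is onto by interpolation. *)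
Lemma points_ideal_reduced_scheme : reduced_zero_dim_scheme (points_ideal p) r.
Proof.
split; last exact: points_ideal_radical.
split; [exact: points_ideal_is_ideal|exact: points_ideal_homogeneous|
        exact: points_ideal_saturated|].
exists r => e lere.
have /fin_all_exists2[b hb bP] := fun i => interpolation i lere.
exists b; split=> // f hf.
have PE (c : {ffun 'I_r -> F}) :
    points_ideal p (f - \sum_i c i *: b i) <-> forall i, f.@[p i] = c i.
  have hfb : f - \sum_i c i *: b i \is e.-homog.
    by apply: rpredB => //; apply: rpred_sum => i _; apply/rpredZ/hb.
  have evE j : (f - \sum_i c i *: b i).@[p j] = f.@[p j] - c j.
    rewrite mevalB (raddf_sum (meval (p j))) (bigD1 j) //= mevalZ bP eqxx mulr1 big1 ?addr0 //.
    by move=> i neij; rewrite mevalZ bP (negPf neij) mulr0.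
  split=> [/(points_ideal_homogP hfb) ev i|ev].
    by apply/eqP; rewrite -subr_eq0 -evE ev.
  by apply/(points_ideal_homogP hfb) => i; rewrite evE ev subrr.
exists [ffun i => f.@[p i]]; split=> [|c /PE ev].
  by apply/PE => i; rewrite ffunE.
by apply/ffunP => i; rewrite ffunE ev.
Qed.

End Fixed.

End PointsIdeal.

(** * Reduced schemes are smoothable *)

Section ConstantFamily.

Variables (n r : nat) (k : fieldType) (p : 'I_r -> 'I_n -> k).
Hypothesis distinct_p : distinct_points p.

(** The constant family over the affine line with coordinate ['X], near the
    origin.  A polynomial over [{poly k}] vanishes on the generic fibre exactly
    when its restrictions to the lines through the points vanish, which
    specialization to the origin preserves; conversely a polynomial over [k] is
    the specialization of itself, taken with constant coefficients. *)
Lemma points_ideal_smoothable : smoothable_scheme (points_ideal p) r.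
Proof.
split; first by case: (points_ideal_reduced_scheme distinct_p).
exists {poly k}, polyC, (horner_eval 0), 'X; split.
  split; rewrite /= ?/horner_eval ?hornerX ?polyX_eq0 //.
    by move=> c; rewrite /= /horner_eval hornerC.
  move=> a a0; have [m [u]] := multiplicity_XsubC a 0.
  rewrite a0 subr0 /= => u0 ->; exists m, u.
  by rewrite /horner_eval -rootE.
have tofrac_inj : injective (@tofrac {poly k}).
  by move=> a b /eqP; rewrite tofrac_eq => /eqP.
pose pR i s : {poly k} := (p i s)%:P.
pose pK i s : {fraction {poly k}} := tofrac (pR i s).
have JE i (G : {mpoly {poly k}[n]}) :
    restrict_line (pK i) (map_mpoly (@tofrac _) G) = 0 <-> restrict_line (pR i) G = 0.
  rewrite -[restrict_line _ _](map_restrict_line (@tofrac {poly k}) (pR i)).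
  split=> [E|->]; last exact: rmorph0.
  apply: (map_inj_poly (f := @tofrac {poly k})); [exact: tofrac_inj|exact: rmorph0|].
  by rewrite E map_poly0.
exists (points_ideal pK); split.
  apply: points_ideal_reduced_scheme; split=> [i|i j /(distinct_p.2 i j) [s [t st]]].
    by have [s ps] := distinct_p.1 i; exists s; rewrite tofrac_eq0 polyC_eq0.
  exists s, t; apply: contra_neq st; rewrite -!rmorphM => /tofrac_inj.
  exact: polyC_inj.
pose S g := exists G, points_ideal pK (map_mpoly (@tofrac {poly k}) G) /\
  g = map_mpoly (horner_eval 0) G.
have IS f : points_ideal p f -> S f.
  move=> If; exists (map_mpoly polyC f); split=> [i|].
    apply/JE; rewrite -map_restrict_line If; exact: rmorph0.
  by apply/mpolyP => m; rewrite !mcoeff_map_mpoly /= /horner_eval hornerC.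
have SI f : S f -> points_ideal p f.
  move=> [G [JG ->]] i; have /JE/(congr1 (map_poly (horner_eval 0))) := JG i.
  rewrite map_restrict_line rmorph0 => <-; apply: eq_restrict_line => s.
  by rewrite /= /horner_eval hornerC.
move=> f; split=> [If|[N SN]].
  by exists 0%N => g _; apply/IS; apply: (idealM (points_ideal_is_ideal p)).
apply: (points_ideal_saturated distinct_p); exists N => g /SN; exact: SI.
Qed.

End ConstantFamily.

(** * Powers of linear forms *)

Section PowersSpan.

Variables (n : nat) (k : fieldType).
Hypothesis hchar : [pchar k] =i pred0.
Implicit Types (f g l : {mpoly k[n]}).

Lemma natr_inj_pchar0 (i j : nat) : i%:R = j%:R :> k -> i = j.
Proof.
wlog leij : i j / (i <= j)%N => [WL|/eqP].
  by case/orP: (leq_total i j) => /WL // + /esym => /[apply].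
rewrite eq_sym -subr_eq0 -natrB // ((pcharf0P k).1 hchar) subn_eq0 => leji.
by apply/eqP; rewrite eqn_leq leij.
Qed.

(** In characteristic 0 the nodes [0], ..., [e.+1] are distinct, so their
    Vandermonde matrix is invertible: some combination of the evaluations at
    these nodes extracts the coefficient of degree 1. *)
Lemma moment_weights e : exists w : 'I_e.+2 -> k, forall i : 'I_e.+2,
  \sum_j w j * j%:R ^+ i = (i == 1%N :> nat)%:R.
Proof.
pose V := Vandermonde e.+2 (\row_(j < e.+2) (j%:R : k)).
have Vunit : V \in unitmx.
  rewrite unitmxE det_Vandermonde unitfE; apply/prodf_neq0 => i _.
  apply/prodf_neq0 => j ltij; rewrite !mxE subr_eq0.
  by apply: contraTneq ltij => /natr_inj_pchar0 ->; rewrite ltnn.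
pose u : 'cV[k]_e.+2 := \col_i (i == 1%N :> nat)%:R.
exists (fun j => (invmx V *m u) j 0) => i.
have /colP/(_ i) : V *m (invmx V *m u) = u by rewrite mulKVmx.
rewrite !mxE => <-; apply: eq_bigr => j _.
by rewrite !mxE mulrC.
Qed.

(** The left side is, up to the factor [e.+1], the coefficient of degree 1 of
    [(l + t x) ^ e.+1] in [t]; it is recovered from the values at
    [t = 0], ..., [e.+1]. *)
Lemma pow_mul_linear_combination e : exists w : 'I_e.+2 -> k,
  forall l x, l ^+ e * x = \sum_j w j *: (l + j%:R *: x) ^+ e.+1.
Proof.
have [w wP] := moment_weights e; exists (fun j => e.+1%:R^-1 * w j) => l x.
have e0 : e.+1%:R != 0 :> k by rewrite ((pcharf0P k).1 hchar).
apply: (scalerI e0); rewrite scaler_sumr.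
under eq_bigr do rewrite scalerA mulrA divff // mul1r exprDn scaler_sumr.
rewrite exchange_big /=.
rewrite (eq_bigr (fun i : 'I_e.+2 => (i == 1%N :> nat)%:R *:
  (l ^+ (e.+1 - i) * x ^+ i *+ 'C(e.+1, i)))) => [|i _]; last first.
  rewrite -wP scaler_suml; apply: eq_bigr => j _.
  by rewrite exprZn -scalerAr !scalerMnr scalerA.
rewrite (bigD1 (Ordinal (isT : 1 < e.+2)%N)) //= big1 ?addr0 => [|i nei1].
  by rewrite subSS subn0 expr1 bin1 scale1r scaler_nat.
by rewrite -val_eqE /= in nei1; rewrite (negPf nei1) scale0r.
Qed.

(** The span is defined as the smallest subspace, which makes it monotone in [ls]
    without any manipulation of coefficients. *)
Definition in_span_pow d (ls : seq {mpoly k[n]}) f : Prop :=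
  forall S : {mpoly k[n]} -> Prop, S 0 ->
  (forall c g h, S g -> S h -> S (c *: g + h)) ->
  (forall l, l \in ls -> S (l ^+ d)) -> S f.

(** By induction a monomial is a variable times a combination of powers
    [l ^+ d], and each such product is a combination of powers of degree
    [d.+1]. *)
Lemma monomial_span_pow d m : mdeg m = d ->
  exists ls, (forall l, l \in ls -> l \is 1.-homog) /\ in_span_pow d ls 'X_[m].
Proof.
elim: d m => [|d IH] m degm.
  exists [:: 0]; split=> [l|S S0 Slin Spow]; first by rewrite inE => /eqP ->; apply: rpred0.
  move/eqP: degm; rewrite mdeg_eq0 => /eqP ->; rewrite mpolyX0.
  by have := Spow 0; rewrite expr0; apply; apply: mem_head.
have [i le1m] : exists i, (U_(i) <= m)%MM.
  apply: NNPP => no; suff : mdeg m = 0%N by rewrite degm.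
  rewrite mdegE big1 // => i _; apply/eqP; apply: contra_notT no => mi.
  by exists i; rewrite lep1mP.
have degm' : mdeg (m - U_(i)) = d.
  by move: degm; rewrite -{1}(submK le1m) mdegD mdeg1 addn1 => -[].
have [ls [hls span]] := IH _ degm'.
exists [seq l + j%:R *: 'X_i | l <- ls, j <- iota 0 d.+2]; split.
  move=> _ /allpairsP[[l j] [/= lls _ ->]].
  by rewrite rpredD ?rpredZ ?homog_variable ?hls.
move=> S S0 Slin Spow; rewrite -(submK le1m) mpolyXD.
apply: (span (fun g => S (g * 'X_i))) => [|c g h Sg Sh|l lls].
- by rewrite mul0r.
- by rewrite mulrDl -scalerAl; apply: Slin.
- have [w ->] := pow_mul_linear_combination d.
  apply: big_ind => [//|g h Sg Sh|j _]; first by rewrite -[g]scale1r; apply: Slin.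
  rewrite -[_ *: _]addr0; apply: Slin => //; apply: Spow.
  by apply/allpairsP; exists (l, val j); rewrite mem_iota ltn_ord.
Qed.

Lemma waring_exists d : exists r (l : 'I_r -> {mpoly k[n]}),
  (forall i, l i \is 1.-homog) /\
  forall f, f \is d.-homog -> exists c : 'I_r -> k, f = \sum_i c i *: l i ^+ d.
Proof.
have [ls [hls span]] : exists ls, (forall l, l \in ls -> l \is 1.-homog) /\
    forall m : 'X_{1..n < d.+1}, mdeg m = d -> in_span_pow d ls 'X_[m].
  have /fin_all_exists[ls lsP] : forall m : 'X_{1..n < d.+1}, exists ls,
      (forall l, l \in ls -> l \is 1.-homog) /\
      (mdeg m = d -> in_span_pow d ls 'X_[m]).
    move=> m; have [/monomial_span_pow[ls [hls span]]|nedm] := eqVneq (mdeg m) d.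
      by exists ls; split.
    by exists [::]; split=> // /eqP; rewrite (negPf nedm).
  exists (flatten [seq ls m | m <- enum {: 'X_{1..n < d.+1}}]); split.
    by move=> l /flatten_mapP[m _ /(lsP m).1].
  move=> m degm S S0 Slin Spow; apply: (lsP m).2 => // l lls.
  by apply/Spow/flatten_mapP; exists m; rewrite ?mem_enum.
exists (size ls), (fun i => nth 0 ls i); split=> [i|f homf].
  exact/hls/mem_nth.
pose S g := exists c : 'I_(size ls) -> k, g = \sum_i c i *: ls`_i ^+ d.
have S0 : S 0 by exists (fun=> 0); rewrite big1 // => i _; rewrite scale0r.
have Slin c g h : S g -> S h -> S (c *: g + h).
  move=> [cg ->] [ch ->]; exists (fun i => c * cg i + ch i).
  by rewrite scaler_sumr -big_split /=; apply: eq_bigr => i _; rewrite scalerDl scalerA.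
have Spow l : l \in ls -> S (l ^+ d).
  move=> lls; have ilt : (index l ls < size ls)%N by rewrite index_mem.
  exists (fun i => (i == Ordinal ilt)%:R); rewrite (bigD1 (Ordinal ilt)) //= eqxx.
  rewrite scale1r nth_index // big1 ?addr0 // => i /negPf ->.
  by rewrite scale0r.
rewrite -/(S f) [f]mpolyE big_seq; apply: big_ind => [//|g h Sg Sh|m /(homog_mdeg homf) degm].
  by rewrite -[g]scale1r; apply: Slin.
rewrite -[_ *: _]addr0; apply: (Slin) => //.
have ltm : (mdeg m < d.+1)%N by rewrite degm.
exact: (span (BMultinom ltm) degm S S0 Slin Spow).
Qed.

End PowersSpan.

(** * Reduction to distinct points *)

Section DistinctPoints.

Variables (n d : nat) (k : fieldType).
Hypothesis hnd : (0 < n)%N \/ (0 < d)%N.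

Lemma restrict_line_kills_pow a Theta : restrict_line a Theta = 0 ->
  diff_act Theta (linear_form a ^+ d) = 0 :> {mpoly k[n]}.
Proof.
move=> I0; rewrite (pihomog_partitionE (leqnn (msize Theta))).
rewrite -/(apply_to _ _) linear_sum big1 // => e _ /=; rewrite /apply_to.
rewrite (diff_act_linear_form_pow _ _ (pihomogP _ _ _)).
by rewrite -coef_restrict_line I0 coef0 mulr0 scale0r.
Qed.

Lemma proportional_linear_form (a b : 'I_n -> k) s : a s != 0 ->
  (forall t, a s * b t = a t * b s) ->
  linear_form b = (b s / a s) *: linear_form a.
Proof.
move=> as0 prop; rewrite /linear_form scaler_sumr; apply: eq_bigr => t _.
rewrite scalerA; congr (_ *: _); apply: (mulfI as0).
by rewrite prop; field.
Qed.

(** The linear form [l ord0] contributes a new point unless the points already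
    chosen handle its power.  If it is proportional to one of them, they do; if
    it is zero, so is its power, except in degree 0.  In degree 0 all powers
    equal 1, and any one point of projective space will do. *)
Lemma exists_distinct_points r (l : 'I_r -> {mpoly k[n]}) :
  (forall i, l i \is 1.-homog) ->
  exists r' (p : 'I_r' -> 'I_n -> k), [/\ (r' <= r)%N, distinct_points p &
    forall i Theta, points_ideal p Theta -> diff_act Theta (l i ^+ d) = 0].
Proof.
elim: r l => [|r IH] l hl.
  by exists 0%N, (fun=> fun=> 0); split=> //; [split|] => -[].
have [r' [p [ler' dp pl]]] := IH (fun i => l (lift ord0 i)) (fun i => hl _).
case: (classic (forall Theta, points_ideal p Theta ->
                diff_act Theta (l ord0 ^+ d) = 0)) => [p0|np0].
  exists r', p; split=> [||i]; [exact: leqW|exact: dp|].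
  by case: (unliftP ord0 i) => [i' ->|->]; [apply: pl|apply: p0].
pose a i := (l ord0)@_U_(i); have l0E := linear_formE (hl ord0).
rewrite -/a in l0E.
suff [b [b0 bp bl]] : exists b : 'I_n -> k, [/\ exists s, b s != 0,
    forall i, exists s t, p i s * b t != p i t * b s &
    forall Theta, restrict_line b Theta = 0 -> points_ideal p Theta ->
      diff_act Theta (l ord0 ^+ d) = 0].
  exists r'.+1, (fun i => oapp p b (unlift ord0 i)); split=> //; last first.
    move=> i Theta Ip.
    have Ip' : points_ideal p Theta by move=> j; have := Ip (lift ord0 j); rewrite liftK.
    case: (unliftP ord0 i) => [i' ->|->]; first exact: pl.
    by apply: bl => //; have := Ip ord0; rewrite unlift_none.
  split=> [i|i j]; first by case: (unliftP ord0 i) => [i' _|_] //=; apply: dp.1.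
  case: (unliftP ord0 i) => [i' ->|->]; case: (unliftP ord0 j) => [j' ->|->] //=;
    rewrite ?liftK ?unlift_none /=.
    by rewrite (inj_eq lift_inj) => /dp.2.
  by move=> _; have [s [t st]] := bp j'; exists t, s; rewrite mulrC [b s * _]mulrC.
have kills_p i Theta : points_ideal p Theta ->
    diff_act Theta (linear_form (p i) ^+ d) = 0.
  by move=> /(_ i); apply: restrict_line_kills_pow.
case: (classic (exists s, a s != 0)) => [a0|no].
  exists a; split=> // [i|Theta Ia _]; last by rewrite l0E restrict_line_kills_pow.
  apply: NNPP => prop; case: np0 => Theta Ip; have [s ps] := dp.1 i.
  have -> : l ord0 = (a s / p i s) *: linear_form (p i).
    apply: (etrans l0E); apply: proportional_linear_form ps _ => t.
    by apply/eqP/negPn/negP => st; apply: prop; exists s, t.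
  by rewrite exprZn linearZ /= kills_p // scaler0.
have l00 : l ord0 = 0.
  rewrite l0E /linear_form big1 // => i _; case: (eqVneq (a i) 0) => [->|ai].
    by rewrite scale0r.
  by case: no; exists i.
have [d0|dpos] := posnP d; last first.
  by case: np0 => Theta _; rewrite l00 expr0n gtn_eqF // linear0.
have powE f : f ^+ d = l ord0 ^+ d by rewrite d0 !expr0.
have npos : (0 < n)%N by case: hnd => //; rewrite d0.
exists (fun=> 1); split=> [|i|Theta Ib _].
- by exists (Ordinal npos); apply: oner_neq0.
- by case: np0 => Theta Ip; rewrite -(powE (linear_form (p i))) kills_p.
- by rewrite -(powE (linear_form (fun=> 1))) restrict_line_kills_pow.
Qed.

End DistinctPoints.

(** * The inequalities between the ranks *)

Theorem theorem5p9 (k : closedFieldType) (hchar : [pchar k] =i pred0)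
    (n d : nat) (hnd : (0 < n)%N \/ (0 < d)%N)
    (W : {pred {mpoly k[n]}}) (hW : is_linear_series d W)
    (delta : nat) (hdelta : (0 < delta)%N)
    (hgen : generated_in_degrees_le (perp W) delta) :
  [/\ (smoothable_rank W <= waring_rank d W)%N,
      (cactus_rank W <= smoothable_rank W)%N &
      (apolar_length W)%:R / delta%:R <= (cactus_rank W)%:R :> rat].
Proof.
have [] := @leastP (fun r => exists l : 'I_r -> {mpoly k[n]},
    (forall i, l i \is 1.-homog) /\
    forall F, F \in W -> exists c : 'I_r -> k, F = \sum_i c i *: l i ^+ d).
  have [r [l [hl span]]] := waring_exists n hchar d.
  by exists r, l; split=> // F /hW.2; apply: span.
rewrite -/(waring_rank d W) => -[l [hl Wspan]] _.
have [r [p [ler dp pl]]] := exists_distinct_points hnd hl.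
have smoothW : exists2 I, smoothable_scheme I r & apolar W I.
  exists (points_ideal p); first exact: points_ideal_smoothable.
  move=> Theta Ip F /Wspan[c ->]; rewrite linear_sum big1 // => i _.
  by rewrite linearZ /= pl ?scaler0.
have [] := @leastP (fun r => exists2 I, smoothable_scheme I r & apolar W I).
  by exists r.
rewrite -/(smoothable_rank W) => smoothS /(_ _ smoothW) leS.
have cactusS : exists2 I, zero_dim_scheme I (smoothable_rank W) & apolar W I.
  by have [I [zI _] aI] := smoothS; exists I.
have [] := @leastP (fun r => exists2 I, zero_dim_scheme I r & apolar W I).
  by exists (smoothable_rank W).
rewrite -/(cactus_rank W) => -[I [idI _ satI [N dimI]] apI] /(_ _ cactusS) leC.
split; [exact: leq_trans leS ler|exact: leC|].
have idW := perp_is_ideal W.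
have depI e s (v : 'I_s -> {mpoly k[n]}) : (N <= e)%N -> (cactus_rank W < s)%N ->
    (forall i, v i \is e.-homog) -> dependent_mod I v.
  by move=> leNe lts hv; apply: (quotient_dim_dependent idI (dimI e leNe)).
(* The linear system whose general member misses the scheme. *)
pose L g := perp W g /\ g \is delta.-homog.
have [||_ []//|a [j aj]|g [Wg hg] reg] :=
    exists_regular_form idI satI depI (delta := delta) (L := L).
- by split; [exact: (ideal0 idW)|exact: rpred0].
- move=> c f g [Wf hf] [Wg hg]; split; last by rewrite rpredD ?rpredZ.
  by apply: (idealD idW) => //; apply: (idealZ idW).
- (* A pure power of ['X_j] lies in [perp W] and is nonzero at [a], so one of the
     generators of [perp W] is nonzero at [a]; multiplying it by a power of ['X_j]
     raises its degree to [delta]. *)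
  have WX : perp W ('X_j ^+ d.+1).
    move=> F /hW.2 hF; apply: diff_act_eq0 hF (ltnSn d).
    exact/homog1X/homog_variable.
  have [s [sP sE]] := hgen _ WX.
  have [q qs qa] : exists2 q, q \in s & q.2.@[a] != 0.
    apply: NNPP => no; have := congr1 (meval a) sE.
    rewrite rmorphXn /= mevalXU aj expr1n raddf_sum big_seq big1 => [/eqP|q qs].
      by rewrite oner_eq0.
    rewrite /= mevalM; case: (eqVneq q.2.@[a] 0) => [->|qa]; first by rewrite mulr0.
    by case: no; exists q.
  have [Wq [e lee hq]] := sP _ qs.
  exists ('X_j ^+ (delta - e) * q.2).
    split; first exact: (idealM idW).
    by have := dhomogM (homog1X (delta - e) (homog_variable k j)) hq; rewrite subnK.
  by rewrite mevalM rmorphXn /= mevalXU aj expr1n mul1r.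
have depW := forms_dependent idI idW apI Wg hg hdelta reg depI.
have [a lea dimW] := quotient_dim_le idW depW.
have [] := @leastP (quotient_dim (fun _ => True) (perp W)); first by exists a.
rewrite -/(apolar_length W) => _ /(_ _ dimW) lel.
rewrite Num.Theory.ler_pdivrMr ?Num.Theory.ltr0n // -natrM Num.Theory.ler_nat mulnC.
exact: leq_trans lel lea.
Qed.
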